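(* Let $d\geq 1$ and $q\geq 2$ be integers, and let $\mathcal M$ be an orientably regular embedding of the $d$-dimensional Hamming graph $H(d,q)$. Then $q$ is a prime power, and if $q>2$ then $\mathcal M$ is isomorphic to a Hamming map $\mathcal H(d,\omega)$ for some generator $\omega$ of the multiplicative group $F_q^*$.
   Context: The Hamming graph $H(d,q)$ has vertex set $Q^d$, where $Q$ is a set with $q$ elements, two vertices $(v_i)$ and $(w_i)$ being adjacent iff $v_i\neq w_i$ for exactly one index $i$. A map is a 2-cell embedding of a connected graph in a compact oriented surface; it is orientably regular if its group $\mathrm{Aut}^+\mathcal M$ of orientation-preserving automorphisms acts transitively on the arcs (directed edges). An orientably regular embedding of a graph $\Gamma$ is an orientably regular map whose underlying graph is isomorphic to $\Gamma$. Maps are isomorphic if there is an orientation-preserving isomorphism between them. Hamming maps: let $q$ be a prime power, $F_q$ the field with $q$ elements, $n=d(q-1)$, $V=F_q^d$ (row vectors) with standard basis $e_1,\dots,e_d$. For a generator $\omega$ of $F_q^*$ let $M_\omega$ be the $d\times d$ matrix with entries $m_{i,i+1}=1$ for $1\le i\le d-1$, $m_{d,1}=\omega$, and all other entries $0$. The Hamming map $\mathcal H(d,\omega)$ is the Cayley map of the additive group $V$ with respect to the generating set $S=\{\lambda e_i:\lambda\in F_q^*,1\le i\le d\}$ (so its graph is $H(d,q)$ with $Q=F_q$), in which the rotation at every vertex $v$ sends the neighbour $v+e_1M_\omega^{i}$ to $v+e_1M_\omega^{i+1}$ (indices mod $n$); i.e. the cyclic order of neighbours of $v$ is $v+e_1,v+e_2,\dots,v+e_d,v+\omega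 e_1,\dots,v+\omega^{q-2}e_d$. *)

(* Defs.v *)
From HB Require Import structures.
From mathcomp Require Import all_boot all_order all_fingroup all_algebra.
From mathcomp Require Import cyclic.

Set Implicit Arguments.
Unset Strict Implicit.
Unset Printing Implicit Defensive.

Import GRing.Theory.
Local Open Scope ring_scope.

(* Finite graphs in the sense used for maps: every edge is a pair of mutually
   reverse arcs; loops and multiple edges are allowed, semi-edges are not. *)
Record graph := Graph {
  vertex : finType;
  garc : finType;
  source : garc -> vertex;
  reverse : garc -> garc;
  reverseK : involutive reverse;
  reverse_neq : forall x, reverse x != x
}.

Definition target (G : graph) (x : garc G) : vertex G := source (reverse x).

Definition gadj (G : graph) : rel (vertex G) :=
  fun u v => [exists x : garc G, (source x == u) && (target x == v)].

Definition connected_graph (G : graph) : Prop :=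
  forall u v : vertex G, connect (@gadj G) u v.

Definition is_graph_iso (G H : graph)
    (f : vertex G -> vertex H) (g : garc G -> garc H) : Prop :=
  [/\ bijective f, bijective g,
      forall x, source (g x) = f (source x)
    & forall x, reverse (g x) = g (reverse x)].

Definition graph_iso (G H : graph) : Prop :=
  exists (f : vertex G -> vertex H) (g : garc G -> garc H), is_graph_iso f g.

(* A 2-cell embedding of a connected graph in a compact oriented surface,
   given by its rotation system (Heffter-Edmonds): a permutation of the arcs
   whose cycles are the cyclic orders, following the orientation of the
   surface, of the arcs leaving each vertex. *)
Record oriented_map := OrientedMap {
  map_graph :> graph;
  rotation : {perm garc map_graph};
  rotation_cycle : forall x y : garc map_graph,
    (source x == source y) = (y \in porbit rotation x);
  map_connected : connected_graph map_graph
}.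

(* Orientation-preserving isomorphisms. *)
Definition is_map_iso (M N : oriented_map)
    (f : vertex M -> vertex N) (g : garc M -> garc N) : Prop :=
  is_graph_iso f g /\ forall x, rotation N (g x) = g (rotation M x).

Definition map_iso (M N : oriented_map) : Prop :=
  exists (f : vertex M -> vertex N) (g : garc M -> garc N), is_map_iso f g.

Definition orientably_regular (M : oriented_map) : Prop :=
  forall x y : garc M,
  exists (f : vertex M -> vertex M) (g : garc M -> garc M),
    is_map_iso f g /\ g x = y.

Definition orientably_regular_embedding (G : graph) (M : oriented_map) : Prop :=
  orientably_regular M /\ graph_iso M G.

Section SimpleGraph.
Variables (T : finType) (e : rel T).
Hypotheses (e_sym : symmetric e) (e_irr : irreflexive e).

Definition simple_arc : finType := {p : T * T | e p.1 p.2}.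

Definition simple_source (a : simple_arc) : T := (val a).1.

Lemma simple_reverse_subproof (a : simple_arc) : e (val a).2 (val a).1.
Proof. by rewrite e_sym; exact: (valP a). Qed.

Definition simple_reverse (a : simple_arc) : simple_arc :=
  exist (fun p : T * T => e p.1 p.2) ((val a).2, (val a).1)
    (simple_reverse_subproof a).

Lemma simple_reverseK : involutive simple_reverse.
Proof. by move=> a; apply: val_inj => /=; rewrite -surjective_pairing. Qed.

Lemma simple_reverse_neq a : simple_reverse a != a.
Proof.
apply: contraFneq (e_irr (val a).1) => eq_a.
have /= E := congr1 (fun b : simple_arc => (val b).1) eq_a.
by move: (valP a); rewrite E.
Qed.

Definition simple_graph : graph :=
  Graph simple_source simple_reverseK simple_reverse_neq.

End SimpleGraph.

Section HammingGraph.
Variables (d : nat) (Q : finType).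

Definition hamming_adj : rel {ffun 'I_d -> Q} :=
  fun v w => #|[set i | v i != w i]| == 1%N.

Lemma hamming_adj_sym : symmetric hamming_adj.
Proof.
move=> v w; rewrite /hamming_adj; congr (#|pred_of_set _| == _).
by apply/setP => i; rewrite !inE eq_sym.
Qed.

Lemma hamming_adj_irr : irreflexive hamming_adj.
Proof.
move=> v; rewrite /hamming_adj (_ : [set i | _] = set0) ?cards0 //.
by apply/setP => i; rewrite !inE eqxx.
Qed.

Definition hamming_graph : graph := simple_graph hamming_adj_sym hamming_adj_irr.

End HammingGraph.

Section HammingMap.
Variables (d : nat) (F : finFieldType).
Implicit Types (v s t : 'rV[F]_d).

Definition hamming_mx (w : F) : 'M[F]_d :=
  \matrix_(i, j)
    if j == i.+1 :> nat then 1
    else if (i.+1 == d) && (j == 0%N :> nat) then w else 0.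

(* The connection set { l e_i : l in F^*, 1 <= i <= d }. *)
Definition hamming_conn : {set 'rV[F]_d} :=
  [set l *: delta_mx 0 i | l in [pred l : F | l != 0], i in 'I_d].

Lemma hamming_connP s :
  reflect (exists (l : F) (i : 'I_d), l != 0 /\ s = l *: delta_mx 0 i)
          (s \in hamming_conn).
Proof.
apply: (iffP imset2P) => [[l i l0 _ ->]|[l [i [l0 ->]]]]; first by exists l, i.
by exists l i.
Qed.

Definition conn_type : finType := {s : 'rV[F]_d | s \in hamming_conn}.

(* The arc (v, s) of the Cayley graph goes from v to v + s. *)
Definition cayley_arc : finType := ('rV[F]_d * conn_type)%type.

Lemma conn_opp_subproof (s : conn_type) : - val s \in hamming_conn.
Proof.
have /hamming_connP[l [i [l0 ->]]] := valP s.
by apply/hamming_connP; exists (- l), i; rewrite oppr_eq0 scaleNr.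
Qed.

Definition cayley_source (x : cayley_arc) : 'rV[F]_d := x.1.

Definition cayley_reverse (x : cayley_arc) : cayley_arc :=
  (x.1 + val x.2, exist (fun s => s \in hamming_conn) (- val x.2) (conn_opp_subproof x.2)).

Lemma conn_neq0 s : s \in hamming_conn -> s != 0.
Proof.
move=> /hamming_connP[l [i [l0 ->]]]; rewrite scaler_eq0 negb_or l0 /=.
by apply/eqP => /rowP/(_ i); rewrite !mxE !eqxx => /eqP; rewrite oner_eq0.
Qed.

Lemma cayley_reverseK : involutive cayley_reverse.
Proof.
case=> v s; rewrite /cayley_reverse /=; congr pair; first by rewrite addrK.
by apply: val_inj => /=; rewrite opprK.
Qed.

Lemma cayley_reverse_neq x : cayley_reverse x != x.
Proof.
apply: contraNneq (conn_neq0 (valP x.2)) => /(congr1 fst)/= /eqP.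
by rewrite -subr_eq0 addrAC subrr add0r.
Qed.

Definition cayley_graph : graph :=
  Graph cayley_source cayley_reverseK cayley_reverse_neq.

Lemma cayley_connected : connected_graph cayley_graph.
Proof.
suff C (w u : 'rV[F]_d) : connect (@gadj cayley_graph) u (u + w).
  by move=> u v; rewrite -[v](subrKC u); exact: C.
rewrite (row_sum_delta w); elim/big_ind: _ u => [u|a b IHa IHb u|i _ u].
- by rewrite addr0.
- by rewrite addrA; exact: connect_trans (IHa u) (IHb _).
have [->|l0] := eqVneq (w 0 i) 0; first by rewrite scale0r addr0.
have Ss : w 0 i *: delta_mx 0 i \in hamming_conn.
  by apply/hamming_connP; exists (w 0 i), i.
apply: connect1; apply/existsP.
by exists ((u, exist (fun s => s \in hamming_conn) _ Ss) : cayley_arc); rewrite !eqxx.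
Qed.

Variable w : {unit F}.

Lemma hamming_mx_next (i j : 'I_d) :
  j = i.+1 :> nat -> delta_mx 0 i *m hamming_mx (val w) = delta_mx 0 j :> 'rV_d.
Proof.
move=> ij; rewrite -rowE; apply/rowP => k; rewrite !mxE -ij !eqxx /=.
by rewrite (ltn_eqF (ltn_ord j)) /= -(inj_eq val_inj) /=; case: eqP.
Qed.

Lemma hamming_mx_last (i j : 'I_d) :
  i.+1 = d -> j = 0%N :> nat ->
  delta_mx 0 i *m hamming_mx (val w) = val w *: delta_mx 0 j :> 'rV_d.
Proof.
move=> id j0; rewrite -rowE; apply/rowP => k; rewrite !mxE id !eqxx /=.
rewrite [k == d :> nat]ltn_eqF // -(inj_eq val_inj) /= j0.
by case: eqP => _; rewrite ?mulr1 ?mulr0.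
Qed.

Lemma unit_neq0 : val w != 0.
Proof. by rewrite -unitfE; exact: (valP w). Qed.

Lemma conn_rot_subproof (s : conn_type) :
  val s *m hamming_mx (val w) \in hamming_conn.
Proof.
have /hamming_connP[l [i [l0 ->]]] := valP s.
rewrite -scalemxAl; apply/hamming_connP.
have [ltid|] := ltnP i.+1 d.
  by exists l, (Ordinal ltid); rewrite (@hamming_mx_next i (Ordinal ltid)).
move=> ledi; have id : i.+1 = d by apply/eqP; rewrite eqn_leq ltn_ord.
have d0 : (0 < d)%N by rewrite -id.
exists (l * val w), (Ordinal d0); rewrite mulf_neq0 ?unit_neq0 //.
by rewrite (@hamming_mx_last i (Ordinal d0)) // scalerA.
Qed.

Definition conn_rot (s : conn_type) : conn_type :=
  exist (fun s => s \in hamming_conn) (val s *m hamming_mx (val w)) (conn_rot_subproof s).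

(* Successor in the cyclic order: the arc to v + e_1 M^i is followed by the
   arc to v + e_1 M^(i+1). *)
Definition hamming_rot_fun (x : cayley_arc) : cayley_arc := (x.1, conn_rot x.2).

Lemma hamming_mx_inj s t :
  s *m hamming_mx (val w) = t *m hamming_mx (val w) -> s = t.
Proof.
move=> /eqP; rewrite -subr_eq0 -mulmxBl => /eqP st0; apply/eqP; rewrite -subr_eq0.
apply/eqP/rowP => i; rewrite [RHS]mxE; move: (s - t) st0 => u.
rewrite {1}(row_sum_delta u) mulmx_suml => /rowP.
have [ltid|ledi] := ltnP i.+1 d.
  move=> /(_ (Ordinal ltid)); rewrite summxE (bigD1 i) //= big1 => [|k ki].
    by rewrite -scalemxAl (@hamming_mx_next i (Ordinal ltid)) //= !mxE !eqxx mulr1 addr0.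
  rewrite -scalemxAl -rowE !mxE /= eqSS eq_sym andbF.
  by rewrite -[X in if X then _ else _]/(k == i) (negPf ki) mulr0.
have id : i.+1 = d by apply/eqP; rewrite eqn_leq ltn_ord.
have d0 : (0 < d)%N by rewrite -id.
move=> /(_ (Ordinal d0)); rewrite summxE (bigD1 i) //= big1 => [|k ki].
  rewrite -scalemxAl (@hamming_mx_last i (Ordinal d0)) //= !mxE !eqxx mulr1 addr0.
  by move/eqP; rewrite mulf_eq0 (negPf unit_neq0) orbF => /eqP.
rewrite -scalemxAl -rowE !mxE /= andbT; case: eqP => [kd|]; last by rewrite mulr0.
by case/eqP: ki; apply: val_inj; apply: succn_inj; rewrite kd id.
Qed.

Lemma hamming_rot_inj : injective hamming_rot_fun.
Proof.
move=> [v s] [v' s'] [-> /hamming_mx_inj st]; congr pair; exact: val_inj.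
Qed.

Definition hamming_rot : {perm cayley_arc} := perm hamming_rot_inj.

Hypothesis gen_w : generator [set: {unit F}] w.

Lemma conn_powers (i0 : 'I_d) s : i0 = 0%N :> nat -> s \in hamming_conn ->
  exists k, s = iter k (mulmx^~ (hamming_mx (val w))) (delta_mx 0 i0).
Proof.
move=> i00 /hamming_connP[l [i [l0 ->]]].
set f := mulmx^~ _.
have fZ k a (x : 'rV_d) : iter k f (a *: x) = a *: iter k f x.
  by elim: k => //= k ->; rewrite /f -scalemxAl.
have step n (j : 'I_d) : j = n :> nat -> iter n f (delta_mx 0 i0) = delta_mx 0 j.
  elim: n j => [|n IHn] j jn /=; first by congr delta_mx; apply: val_inj; rewrite /= jn.
  have ltnd : (n < d)%N by rewrite ltnW // -jn.
  by rewrite (IHn (Ordinal ltnd)) //; exact: hamming_mx_next.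
have turn : iter d f (delta_mx 0 i0) = val w *: delta_mx 0 i0.
  have dE : d.-1.+1 = d by rewrite prednK // (leq_trans _ (ltn_ord i)).
  have ltd : (d.-1 < d)%N by rewrite dE.
  rewrite -[X in iter X]dE /= (step d.-1 (Ordinal ltd)) //.
  exact: hamming_mx_last.
have turns m : iter (m * d) f (delta_mx 0 i0) = val w ^+ m *: delta_mx 0 i0.
  elim: m => [|m IHm]; first by rewrite expr0 scale1r.
  by rewrite mulSn iterD IHm fZ turn scalerA -exprSr.
have Ul : l \is a GRing.unit by rewrite unitfE.
have : FinRing.unit F Ul \in <[w]>%g by rewrite -(eqP gen_w) inE.
case/cycleP=> m /(congr1 val); rewrite FinRing.val_unitX /= => lE.
by exists (i + m * d)%N; rewrite iterD turns fZ (step i i) // -lE.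
Qed.

Lemma hamming_rot_cycle (x y : cayley_arc) :
  (cayley_source x == cayley_source y) = (y \in porbit hamming_rot x).
Proof.
have val_rot k (z : cayley_arc) : (hamming_rot ^+ k)%g z = iter k hamming_rot_fun z.
  by rewrite permX; apply: eq_iter => a; rewrite permE.
have itE k (z : cayley_arc) : (iter k hamming_rot_fun z).1 = z.1 /\
    val (iter k hamming_rot_fun z).2 = iter k (mulmx^~ (hamming_mx (val w))) (val z.2).
  by elim: k => //= k [-> ->].
apply/eqP/idP => [|/porbitP[k ->]]; last first.
  by rewrite val_rot /cayley_source (itE k x).1.
case: x y => v s [v' t]; rewrite /cayley_source /= => <-{v'}.
have /hamming_connP[_ [i _]] := valP s.
have d0 : (0 < d)%N by exact: leq_ltn_trans (ltn_ord i).
set i0 := Ordinal d0.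
have S0 : delta_mx 0 i0 \in hamming_conn.
  by apply/hamming_connP; exists 1, i0; rewrite oner_neq0 scale1r.
pose z : cayley_arc := (v, exist (fun s => s \in hamming_conn) _ S0).
have inz (r : conn_type) : (v, r) \in porbit hamming_rot z.
  have [k rE] := @conn_powers i0 (val r) erefl (valP r).
  apply/porbitP; exists k; rewrite val_rot.
  have [E1 E2] := itE k z; rewrite [RHS]surjective_pairing E1.
  by congr pair; apply: val_inj; rewrite E2 rE.
have /eqP -> : porbit hamming_rot (v, s) == porbit hamming_rot z.
  by rewrite eq_porbit_mem inz.
exact: inz.
Qed.

Definition hamming_map : oriented_map :=
  @OrientedMap cayley_graph hamming_rot hamming_rot_cycle cayley_connected.

Lemma hamming_map_graph : graph_iso hamming_map (hamming_graph d F).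
Proof.
pose f (v : 'rV[F]_d) : {ffun 'I_d -> F} := [ffun i => v 0 i].
pose f' (v : {ffun 'I_d -> F}) : 'rV[F]_d := \row_i v i.
have fK : cancel f f' by move=> v; apply/rowP => i; rewrite mxE ffunE.
have f'K : cancel f' f by move=> v; apply/ffunP => i; rewrite ffunE mxE.
have adjE u v : hamming_adj (f u) (f v) = (v - u \in hamming_conn).
  apply/cards1P/hamming_connP => [[i /setP iE]|[l [i [l0 E]]]].
    exists ((v - u) 0 i), i; split.
      by have := iE i; rewrite !inE !ffunE eqxx !mxE eq_sym -subr_eq0.
    apply/rowP => k; rewrite [RHS]mxE [delta_mx _ _ _ _]mxE eqxx /=.
    have := iE k; rewrite !inE !ffunE.
    have [->|_ /negbFE/eqP E] := eqVneq k i; first by rewrite mulr1.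
    by rewrite mulr0 !mxE E subrr.
  exists i; apply/setP => k; rewrite !inE !ffunE eq_sym -subr_eq0.
  have := congr1 (fun r : 'rV_d => r 0 k) E; rewrite !mxE eqxx /= => ->.
  by rewrite mulf_eq0 (negPf l0) /=; case: (k == i); rewrite ?oner_eq0 ?eqxx.
have gP (x : cayley_arc) : hamming_adj (f x.1) (f (x.1 + val x.2)).
  by rewrite adjE addrC addKr; exact: (valP x.2).
pose P (p : {ffun 'I_d -> F} * {ffun 'I_d -> F}) := hamming_adj p.1 p.2.
pose g (x : cayley_arc) : simple_arc (@hamming_adj d F) :=
  exist P (f x.1, f (x.1 + val x.2)) (gP x).
have hP (a : simple_arc (@hamming_adj d F)) :
    f' (val a).2 - f' (val a).1 \in hamming_conn.
  by rewrite -adjE !f'K; exact: (valP a).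
pose h (a : simple_arc (@hamming_adj d F)) : cayley_arc :=
  (f' (val a).1, exist (fun s => s \in hamming_conn) _ (hP a)).
exists f, g; split.
- by exists f'.
- exists h => [[v s]|a]; last first.
    apply: val_inj => /=; rewrite !f'K subrKC f'K.
    by rewrite -surjective_pairing.
  rewrite /h /=; congr pair; first by rewrite fK.
  by apply: val_inj => /=; rewrite !fK addrC addKr.
- by [].
- by move=> [v s]; apply: val_inj => /=; rewrite addrK.
Qed.

End HammingMap.

(* Main.v *)
Require Import Defs.
From HB Require Import structures.
From mathcomp Require Import all_boot all_order all_fingroup all_algebra.
From mathcomp Require Import cyclic.
From mathcomp Require Import all_solvable finfield mxrepresentation mxabelem vcharacter.

(** Let q > 2. An automorphism of the Hamming graph permutes the d parallel
classes of edges. In an orientably regular embedding the rotation x at a vertex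
u acts on these classes as a d-cycle. The stabiliser of a line (a maximal
clique) is sharply 2-transitive on it, and it is generated by the point
stabilisers, which fix every parallel class. By Frobenius' theorem it has a
regular normal subgroup K, which is elementary abelian because the point
stabiliser acts transitively by conjugation on its nontrivial elements; so q is
a prime power. Comparing orders, K is also the stabiliser of any value of any
other coordinate, so K moves only the coordinate of the line. Conjugation by
x^d turns K into a one-dimensional space over F_q on which x^d is
multiplication by a generator w. The conjugates of K by the powers of x then
generate a regular group of translations, in whose coordinates x is M_w. *)

Set Implicit Arguments.
Unset Strict Implicit.
Unset Printing Implicit Defensive.

(** * Automorphisms of Hamming graphs *)

Section HammingDirections.
Variables (d : nat) (Q : finType).
Local Notation W := {ffun 'I_d -> Q}.
Implicit Types (u v w z : W) (i j k : 'I_d) (a b : Q).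

Definition subst u i a : W := [ffun j => if j == i then a else u j].

Lemma subst_eq u i a : subst u i a i = a.
Proof. by rewrite ffunE eqxx. Qed.

Lemma subst_neq u i a j : j != i -> subst u i a j = u j.
Proof. by rewrite ffunE => /negPf->. Qed.

(** Connectedness as an induction principle: the coordinates of [u] are replaced by those of [v] one
    at a time, along a path of the graph. *)
Lemma subst_ind (P : W -> Prop) u v :
  P u -> (forall w i, u i != v i -> P w -> P (subst w i (v i))) -> P v.
Proof.
move=> Pu step.
have Ps (s : seq 'I_d) : P [ffun j => if j \in s then v j else u j].
  elim: s => [|k s IHs].
    by rewrite (_ : finfun _ = u) //; apply/ffunP => j; rewrite ffunE.
  have [uv|uv] := eqVneq (u k) (v k).
    rewrite (_ : finfun _ = [ffun j => if j \in s then v j else u j]) //.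
    apply/ffunP => j; rewrite !ffunE inE.
    by have [->|//] := eqVneq j k; rewrite uv if_same.
  rewrite (_ : finfun _ = subst [ffun j => if j \in s then v j else u j] k (v k)).
    exact: step.
  by apply/ffunP => j; rewrite !ffunE inE; have [->|] := eqVneq j k.
rewrite (_ : v = [ffun j => if j \in enum 'I_d then v j else u j]) //.
by apply/ffunP => j; rewrite ffunE mem_enum.
Qed.

Definition differ_at i u v := (u i != v i) && [forall j, (j != i) ==> (u j == v j)].

Lemma differ_atP i u v :
  reflect (u i <> v i /\ forall j, j != i -> u j = v j) (differ_at i u v).
Proof.
apply: (iffP andP) => [[/eqP ui /forallP uj]|[/eqP ui uj]]; split=> //.
  by move=> j ji; apply/eqP/(implyP (uj j)).
by apply/forallP => j; apply/implyP => /uj->.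
Qed.

Lemma differ_at_sym i u v : differ_at i u v = differ_at i v u.
Proof.
by apply/differ_atP/differ_atP => -[ui uj]; split=> [/esym//|j ji]; rewrite uj.
Qed.

Lemma differ_at_subst i u a : a != u i -> differ_at i u (subst u i a).
Proof.
move=> ai; apply/differ_atP; split; first by rewrite subst_eq => /esym/eqP; apply/negP.
by move=> j ji; rewrite subst_neq.
Qed.

Lemma differ_atE i u v : differ_at i u v -> v = subst u i (v i).
Proof.
by case/differ_atP=> _ uj; apply/ffunP => j; rewrite ffunE; case: eqVneq => [->|/uj].
Qed.

Lemma differ_at_inj i j u v : differ_at i u v -> differ_at j u v -> i = j.
Proof.
move=> /differ_atP[ui _] /differ_atP[_ uj]; apply/eqP; apply/negP => /negP/uj.
exact: ui.
Qed.

Lemma hamming_adjP u v : reflect (exists i, differ_at i u v) (hamming_adj u v).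
Proof.
apply: (iffP cards1P) => -[i].
  move/setP=> iE; exists i; apply/differ_atP; split.
    by have := iE i; rewrite !inE eqxx => /eqP.
  by move=> j /negPf ji; have := iE j; rewrite !inE ji => /negbFE/eqP.
move=> /differ_atP[ui uj]; exists i; apply/setP => j; rewrite !inE.
by have [->|/uj->] := eqVneq j i; [apply/eqP | rewrite eqxx].
Qed.

Lemma differ_at_adj i u v : differ_at i u v -> hamming_adj u v.
Proof. by move=> uv; apply/hamming_adjP; exists i. Qed.

(** Triangles lie in lines. Whether two edges at [u] are parallel can thus be read off from
    adjacency alone, so graph automorphisms respect it. *)
Lemma differ_at_triangle i j u v w :
  differ_at i u v -> differ_at j u w -> v != w -> hamming_adj v w = (i == j).
Proof.
move=> /differ_atP[ui uv] /differ_atP[wi uw] vw; apply/hamming_adjP/eqP.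
  case=> k /differ_atP[_ vwk]; apply/eqP; apply/negP => /negP ij.
  have ik : i = k.
    apply/eqP; apply/negP => /negP ik; apply: ui.
    by rewrite vwk // uw.
  by apply: wi; rewrite -vwk ?uv // -?ik eq_sym.
move=> ij; exists i; subst j; apply/differ_atP; split; last first.
  by move=> j ji; rewrite -uv ?uw.
move=> vwi; case/eqP: vw; apply/ffunP => k.
by have [->|ki] := eqVneq k i; rewrite // -uv ?uw.
Qed.

(** Besides [u], the only common neighbour of [v] and [w] is the fourth corner of a coordinate
    square. This detects parallel edges at different vertices. *)
Lemma induced_square_parallel i j u v w z :
  differ_at i u v -> differ_at j u w -> i != j ->
  hamming_adj v z -> hamming_adj w z -> ~~ hamming_adj u z -> u != z ->
  differ_at i w z.
Proof.
move=> uv uw ij /hamming_adjP[k vz] /hamming_adjP[l wz] uz nuz.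
have ki : k != i.
  apply: contraNneq uz => ki; subst k.
  rewrite differ_at_sym in uv.
  by rewrite (differ_at_triangle uv vz) ?eqxx.
have zE := differ_atE vz.
have [/differ_atP[ui uvE] /differ_atP[uj uwE]] := (uv, uw).
have li : l = i.
  apply/eqP; apply/negP => /negP li; case/differ_atP: wz => _ wz; apply: ui.
  by rewrite uwE // wz 1?eq_sym // zE subst_neq // eq_sym.
by rewrite -li.
Qed.

(** Phrased with level sets instead of edges: [s] carries the partition by coordinate [i] to the one
    by coordinate [sg i]. The version for edges is [directions_differ]. *)
Definition directions (s : {perm W}) (sg : {perm 'I_d}) :=
  forall u v i, (s u (sg i) == s v (sg i)) = (u i == v i).

Section Automorphism.
Variable s : {perm W}.
Hypothesis Q3 : (2 < #|Q|)%N.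
Hypothesis s_adj : forall u v, hamming_adj (s u) (s v) = hamming_adj u v.

Lemma third_element a b : exists c : Q, c != a /\ c != b.
Proof.
have : (0 < #|~: [set a; b]|)%N.
  rewrite cardsCs setCK subn_gt0 (leq_ltn_trans _ Q3) // cards2.
  by case: eqP.
by case/card_gt0P=> c; rewrite !inE negb_or => /andP[]; exists c.
Qed.

Lemma other_element a : exists c : Q, c != a.
Proof. by have [c []] := third_element a a; exists c. Qed.

(** Triangles give a map of directions at each vertex; induced squares show that it does not change
    along an edge, so by connectedness it is the same everywhere. *)
Lemma automorphism_directions : exists sg, directions s sg.
Proof.
have same i u v w k : differ_at i u v -> differ_at i u w ->
    differ_at k (s u) (s v) -> differ_at k (s u) (s w).
  move=> uv uw suv; have [<-//|vw] := eqVneq v w.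
  have /hamming_adjP[l suw] : hamming_adj (s u) (s w).
    by rewrite s_adj (differ_at_adj uw).
  have := differ_at_triangle suv suw; rewrite (inj_eq perm_inj) s_adj => /(_ vw).
  by rewrite (differ_at_triangle uv uw vw) eqxx => /esym/eqP->.
have distinct i j u v w k l : i != j -> differ_at i u v -> differ_at j u w ->
    differ_at k (s u) (s v) -> differ_at l (s u) (s w) -> k != l.
  move=> ij uv uw suv suw.
  have vw : v != w.
    by apply: contraNneq ij => vw; apply/eqP/(differ_at_inj uv); rewrite vw.
  have := differ_at_triangle suv suw; rewrite (inj_eq perm_inj) s_adj => /(_ vw).
  by rewrite (differ_at_triangle uv uw vw) (negPf ij) => <-.
pose maps u i k := forall v, differ_at i u v -> differ_at k (s u) (s v).
have mapsP u i : exists k, maps u i k.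
  have [a ai] := other_element (u i); have ua := differ_at_subst ai.
  have /hamming_adjP[k sua] : hamming_adj (s u) (s (subst u i a)).
    by rewrite s_adj (differ_at_adj ua).
  by exists k => v uv; exact: same ua uv sua.
have transport u i k j a : maps u i k -> maps (subst u j a) i k.
  move=> mk; have [->|au] := eqVneq a (u j).
    rewrite (_ : subst _ _ _ = u) //.
    by apply/ffunP => l; rewrite ffunE; case: eqP => // ->.
  have uw := differ_at_subst au; set w := subst u j a in uw *.
  have [ij|ij] := eqVneq i j.
    subst j; have swu := mk _ uw; rewrite differ_at_sym in swu.
    rewrite differ_at_sym in uw.
    by move=> v wv; exact: same uw wv swu.
  (* By [same], one edge in direction [i] at [w] suffices: the one opposite to [uv] in the square
     [u], [v], [z], [w]. *)
  suff [v wv swv] : exists2 v, differ_at i w v & differ_at k (s w) (s v).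
    by move=> v' wv'; exact: same wv wv' swv.
  have [b bu] := other_element (u i); have uv := differ_at_subst bu.
  set v := subst u i b in uv *.
  pose z := subst w i b; have wi : w i = u i by rewrite subst_neq.
  have wz : differ_at i w z by apply: differ_at_subst; rewrite wi.
  have vz : differ_at j v z.
    have -> : z = subst v j a.
      apply/ffunP => l; rewrite !ffunE; have [->|//] := eqVneq l i.
      by rewrite (negPf ij).
    by apply: differ_at_subst; rewrite subst_neq // eq_sym.
  exists z => //.
  have [l suw] := hamming_adjP _ _ (etrans (s_adj u w) (differ_at_adj uw)).
  have uz : u != z.
    by apply/eqP => /ffunP/(_ i)/eqP; rewrite subst_eq eq_sym (negPf bu).
  have kl := distinct _ _ _ _ _ _ _ ij uv uw (mk _ uv) suw.
  apply: (induced_square_parallel (mk _ uv) suw kl).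
  - by rewrite s_adj (differ_at_adj vz).
  - by rewrite s_adj (differ_at_adj wz).
  - rewrite s_adj; apply/hamming_adjP => -[m /differ_atP[_ uzm]].
    have mi : m = i.
      apply/eqP; apply/negP => /negP mi; have := uzm i; rewrite eq_sym mi => /(_ isT)/eqP.
      by rewrite subst_eq eq_sym (negPf bu).
    have ji : j != i by rewrite eq_sym.
    have := uzm j; rewrite mi ji subst_neq // subst_eq => /(_ isT)/esym/eqP.
    exact/negP.
  - by rewrite (inj_eq perm_inj).
have mapsE u v i k : maps u i k -> maps v i k.
  move=> mu; apply: (subst_ind (P := fun v => maps v i k) (u := u)) => // w j _.
  exact: transport.
have [Q0|/card_gt0P[u0 _]] := posnP #|{: W}|.
  exists 1%g => u; by have := card0_eq Q0 u; rewrite inE.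
have [f fE] : exists f : {ffun 'I_d -> 'I_d}, forall u i, maps u i (f i).
  have ex i : {k | [forall v, differ_at i u0 v ==> differ_at k (s u0) (s v)]}.
    apply/sigW; have [k mk] := mapsP u0 i; exists k.
    by apply/forallP => v; apply/implyP/mk.
  exists [ffun i => sval (ex i)] => u i; rewrite ffunE; apply: (mapsE u0) => v uv.
  by have /forallP/(_ v)/implyP := svalP (ex i); apply.
have f_inj : injective f.
  move=> i j fij; apply/eqP; apply/negP => /negP ij.
  have [a ai] := other_element (u0 i); have [b bj] := other_element (u0 j).
  have ua := differ_at_subst ai; have ub := differ_at_subst bj.
  by have := distinct _ _ _ _ _ _ _ ij ua ub (fE _ _ _ ua) (fE _ _ _ ub); rewrite fij eqxx.
exists (perm f_inj) => u v i; rewrite permE.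
(* The path from [u'] to [v'] changes only coordinates other than [i], so the images change only in
   coordinates other than [f i]. *)
have keep u' v' : u' i = v' i -> s u' (f i) = s v' (f i).
  move=> uvi; apply: (subst_ind (P := fun w => s u' (f i) = s w (f i)) (u := u')) => //.
  move=> w j uvj ->; have [vw|vw] := eqVneq (v' j) (w j).
    rewrite vw (_ : subst _ _ _ = w) //.
    by apply/ffunP => l; rewrite ffunE; case: eqP => // ->.
  have /differ_atP[_] := fE w j _ (differ_at_subst vw); apply.
  by rewrite (inj_eq f_inj); apply: contraNneq uvj => <-; rewrite uvi.
have [uvi|uvi] := eqVneq (u i) (v i); first by rewrite (keep u v) ?eqxx.
have vu : v i != u i by rewrite eq_sym.
(* By [keep], [v] may be replaced by a vertex with the same coordinate [i] that is adjacent to [u]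
   in direction [i]. *)
rewrite -(keep (subst u i (v i)) v) ?subst_eq //.
by have /differ_atP[/eqP/negPf-> _] := fE u i _ (differ_at_subst vu).
Qed.

End Automorphism.
End HammingDirections.

(** * Cyclic automorphisms of elementary abelian groups *)

Section AbelemField.
Import GroupScope GRing.Theory.
Local Open Scope ring_scope.

(* [w] is a root in F of the minimal polynomial over F_p of conjugation by c. *)
Lemma abelem_field_model (gT : finGroupType) (p : nat) (K : {group gT})
    (c t1 : gT) (F : finFieldType) :
  p.-abelem K -> c \in 'N(K)%g -> t1 \in K -> t1 != 1%g ->
  (forall t, t \in K -> t != 1%g -> exists m, t = (t1 ^ (c ^+ m))%g) ->
  #|F| = #|K| ->
  exists (w : F) (th : gT -> F),
    [/\ th t1 = 1, {in K &, {morph th : a b / (a * b)%g >-> a + b}},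
        {in K &, injective th} & {in K, forall a, th (a ^ c)%g = w * th a}].
Proof.
move=> abelK Nc Kt1 nt1 orb cardF.
have ntK : K :!=: 1%g.
  by apply: contraNneq nt1 => K1; rewrite -in_set1 -[[set 1%g]]K1.
have [p_pr _ [n cardK]] := pgroup_pdiv (abelem_pgroup abelK) ntK.
have charF : p \in [pchar F] by apply: (card_finPcharP (n := n.+1)); rewrite ?cardF.
have nKC : <[c]>%g \subset 'N(K)%g by rewrite cycle_subG.
pose rG := abelem_repr abelK ntK nKC.
pose E := abelem_rV abelK ntK.
pose B := rG c.
have Cc : c \in <[c]>%g := cycle_id c.
have EJ a : a \in K -> E (a ^ c)%g = E a *m B.
  by move=> Ka; rewrite /E (abelem_rV_J abelK ntK nKC).
have EJn m a : a \in K -> E (a ^ (c ^+ m))%g = E a *m B ^+ m.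
  move=> Ka; elim: m => [|m IHm]; first by rewrite expg0 conjg1 expr0 mulmx1.
  rewrite expgSr conjgM EJ ?IHm ?exprSr ?mulmxA //.
  by rewrite memJ_norm // groupX.
pose e1 := E t1.
have e1n0 : e1 != 0.
  rewrite -(abelem_rV_1 abelK ntK); apply: contraNneq nt1.
  by move/(abelem_rV_inj Kt1 (group1 K)) ->.
have gen v : v != 0 -> exists m, v = e1 *m B ^+ m.
  move=> v0; pose t := rVabelem abelK ntK v.
  have Kt : t \in K by exact: mem_rVabelem.
  have nt : t != 1%g.
    apply: contraNneq v0 => tE; rewrite -(rVabelemK abelK ntK v) -/t tE.
    by rewrite (abelem_rV_1 abelK ntK).
  have [m tE] := orb t Kt nt; exists m.
  by rewrite -EJn // -tE /t /E rVabelemK.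
have hX k : e1 *m horner_mx B 'X^k = e1 *m B ^+ k by rewrite rmorphXn /= horner_mx_X.
(* Every nonzero vector is [e1] times a power of [B], and polynomials in [B] commute; so one that
   kills [e1] vanishes. *)
have ann f : e1 *m horner_mx B f = 0 -> horner_mx B f = 0.
  move=> f0; apply/row_matrixP => i; rewrite rowE row0.
  have [|v0] := eqVneq (delta_mx 0 i : 'rV['F_p]__) 0; first by move->; rewrite mul0mx.
  have [m ->] := gen _ v0.
  rewrite -hX -mulmxA mulmxE -rmorphM mulrC rmorphM /= -mulmxE mulmxA f0.
  by rewrite mul0mx.
have iota : {rmorphism 'F_p -> F} :=
  (GRing.in_alg (pPrimeCharType charF) : {rmorphism 'F_p -> pPrimeCharType charF}).
have cardK1 : #|K| = #|'rV['F_p]_('dim K)|.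
  by rewrite -[RHS]cardsT -(card_isog (isom_isog _ _ (abelem_rV_isom abelK ntK))).
(* Multiplication by [B] permutes the nonzero vectors in a single cycle, of length [#|K|.-1]. *)
have ordB : e1 *m B ^+ #|K|.-1 = e1.
  pose f (v : 'rV['F_p]_('dim K)) := v *m B.
  have f_inj : injective f.
    apply: (can_inj (g := mulmx^~ (rG c^-1%g))) => v.
    by rewrite /f -mulmxA -repr_mxM ?groupV // mulgV repr_mx1 mulmx1.
  have iterE k : iter k f e1 = e1 *m B ^+ k.
    elim: k => [|k IHk]; first by rewrite expr0 mulmx1.
    by rewrite iterS IHk /f -mulmxA mulmxE -exprSr.
  suff <- : fingraph.order f e1 = #|K|.-1 by rewrite -iterE iter_order.
  rewrite cardK1 -(cardC1 0); apply: eq_card => v; rewrite !inE.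
  apply/idP/idP => [/iter_findex <-|/gen[k ->]]; last by rewrite -iterE fconnect_iter.
  elim: findex => //= k; apply: contraNneq => fk0.
  by apply/eqP/f_inj; rewrite fk0 /f mul0mx.
(* [B] is a root of ['X^#|F| - 'X], which splits over [F]; hence so does the nonconstant minimal
   polynomial of [B]. *)
have [w rw] : exists w : F, root (map_poly iota (mxminpoly B)) w.
  have dv : mxminpoly B %| 'X^#|F| - 'X.
    rewrite dvd_mxminpoly; apply/eqP/ann; rewrite rmorphB mulmxBr hX.
    rewrite /= horner_mx_X cardF -(prednK (cardG_gt0 K)) exprSr -mulmxE mulmxA ordB.
    exact: subrr.
  have : map_poly iota (mxminpoly B) %| 'X^#|F| - 'X.
    have <- : map_poly iota ('X^#|F| - 'X) = 'X^#|F| - 'X.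
      by rewrite rmorphB rmorphXn /= map_polyX.
    by rewrite dvdp_map.
  rewrite finField_genPoly -big_enum /= => /dvdp_prod_XsubC[m].
  set r := mask _ _ => mE.
  have : size (map_poly iota (mxminpoly B)) = (size r).+1.
    by rewrite (eqp_size mE) size_prod_XsubC.
  rewrite size_map_poly size_mxminpoly => -[sz].
  have := mxminpoly_nonconstant B; rewrite sz.
  case: r mE {sz} => // a r mE _; exists a.
  by rewrite (eqp_root mE) root_prod_XsubC mem_head.
(* The map [th] sends the vector [e1] f([B]) to f([w]). This is well defined: if f and g give the
   same vector, the minimal polynomial divides f - g by [ann], and [w] is a root of it. *)
pose ev f := (map_poly iota f).[w].
have evP f g : e1 *m horner_mx B f = e1 *m horner_mx B g -> ev f = ev g.
  move=> fg; apply/eqP; rewrite -subr_eq0.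
  have -> : ev f - ev g = ev (f - g) by rewrite /ev rmorphB hornerD hornerN.
  have /ann/mxminpoly_minP dv : e1 *m horner_mx B (f - g) = 0.
    by rewrite rmorphB mulmxBr fg subrr.
  have := dv; rewrite -(dvdp_map iota) => /dvdpP[r] rE; rewrite /ev rE.
  by rewrite hornerM (rootP rw) mulr0 eqxx.
have pol v : exists f, e1 *m horner_mx B f == v.
  have [->|v0] := eqVneq v 0; first by exists 0; rewrite rmorph0 mulmx0.
  by have [k ->] := gen v v0; exists 'X^k; rewrite hX.
pose P v := xchoose (pol v).
have PE v : e1 *m horner_mx B (P v) = v by apply/eqP/(xchooseP (pol v)).
have evX k : ev 'X^k = w ^+ k by rewrite /ev rmorphXn /= map_polyX hornerXn.
have w0 : w ^+ #|K|.-1 = 1.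
  rewrite -evX -[RHS](_ : ev 1 = 1); last by rewrite /ev rmorph1 hornerC.
  by apply: evP; rewrite hX ordB rmorph1 mulmx1.
exists w, (fun t => ev (P (E t))); split.
- rewrite -[RHS](_ : ev 1 = 1); last by rewrite /ev rmorph1 hornerC.
  by apply: evP; rewrite PE rmorph1 mulmx1.
- move=> a b Ka Kb; rewrite /ev -hornerD -rmorphD; apply: evP.
  by rewrite PE rmorphD mulmxDr !PE /E abelem_rV_M.
- move=> a b Ka Kb eqab; apply: (abelem_rV_inj (abelE := abelK) (ntE := ntK)) => //.
  apply/eqP; rewrite -subr_eq0; apply/negP => /negP ab0.
  (* A nonzero difference is [e1 *m B ^+ k], with value [w ^+ k]; this is not 0 because [w0]
     excludes [w = 0]. *)
  have [k abE] := gen _ ab0.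
  have : ev (P (E a) - P (E b)) = ev 'X^k.
    by apply: evP; rewrite rmorphB mulmxBr !PE hX.
  rewrite evX {1}/ev rmorphB hornerD hornerN -[X in X - _]/(ev _) eqab subrr.
  move=> /esym/eqP; rewrite expf_eq0 => /andP[_ /eqP w00].
  move: w0; rewrite w00 cardK; have : (1 < p ^ n.+1)%N.
    by rewrite -cardK cardG_gt1.
  by case: (p ^ n.+1)%N => [|[|k']] //= _; rewrite expr0n /= => /eqP; rewrite eq_sym oner_eq0.
- move=> a Ka; rewrite /= -[w]expr1 -evX /ev -hornerM -rmorphM; apply: evP.
  by rewrite PE EJ // expr1 mulrC rmorphM /= horner_mx_X -mulmxE mulmxA PE.
Qed.

End AbelemField.

(** * Regular rotation systems on the Hamming graph *)

Section RotationAutomorphisms.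
Import GroupScope.
Variables (d : nat) (Q : finType).
Local Notation W := {ffun 'I_d -> Q}.
Implicit Types (u v w : W) (i j : 'I_d) (s t g : {perm W}) (sg : {perm 'I_d}).

Lemma directions1 : directions (1 : {perm W}) 1.
Proof. by move=> u v i; rewrite !perm1. Qed.

Lemma directions_id s : directions s 1 ->
  forall u v i, (s u i == s v i) = (u i == v i).
Proof. by move=> ds u v i; have := ds u v i; rewrite perm1. Qed.

Lemma directionsM s sg t (tau : {perm 'I_d}) :
  directions s sg -> directions t tau -> directions (s * t) (sg * tau).
Proof. by move=> ds dt u v i; rewrite !permM dt ds. Qed.

Lemma directionsV s sg : directions s sg -> directions s^-1 sg^-1.
Proof. by move=> ds u v i; rewrite -[LHS]ds !permKV. Qed.

Lemma directionsX s sg n : directions s sg -> directions (s ^+ n) (sg ^+ n).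
Proof.
move=> ds; elim: n => [|n IHn]; first by rewrite !expg0; exact: directions1.
by rewrite !expgS; exact: directionsM.
Qed.

Lemma directions_differ s sg i u v :
  directions s sg -> differ_at (sg i) (s u) (s v) = differ_at i u v.
Proof.
move=> ds; apply/differ_atP/differ_atP => -[ui uj]; split.
- by move/eqP; rewrite -ds => /eqP.
- by move=> j ji; apply/eqP; rewrite -ds uj // (inj_eq perm_inj).
- by move/eqP; rewrite ds => /eqP.
- move=> j ji; apply/eqP; rewrite -[j](permKV sg) ds; apply/eqP/uj.
  by rewrite -(inj_eq (@perm_inj _ sg)) permKV.
Qed.

Variable rho : W -> W -> W.

(** Arcs are written as pairs of adjacent vertices, and [rho u v] stands for the neighbour that
    follows [v] in the rotation at [u]. In these terms this is the group of orientation-preserving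
    map automorphisms. *)
Definition rot_aut : {set {perm W}} :=
  [set s : {perm W} | [forall u, forall v, (hamming_adj (s u) (s v) == hamming_adj u v)
     && (hamming_adj u v ==> (rho (s u) (s v) == s (rho u v)))]].

Lemma rot_autP s :
  reflect ((forall u v, hamming_adj (s u) (s v) = hamming_adj u v) /\
           (forall u v, hamming_adj u v -> rho (s u) (s v) = s (rho u v)))
          (s \in rot_aut).
Proof.
rewrite inE; apply: (iffP forallP) => [H|[H1 H2] u].
  split=> u v; have /forallP/(_ v)/andP[/eqP E /implyP R] := H u; first by [].
  by move/R/eqP.
apply/forallP => v; rewrite H1 eqxx /=; apply/implyP => /H2->; exact: eqxx.
Qed.

Lemma rot_aut_group_set : group_set rot_aut.
Proof.
apply/group_setP; split=> [|s t /rot_autP[s1 s2] /rot_autP[t1 t2]].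
  by apply/rot_autP; split=> u v; rewrite !perm1.
apply/rot_autP; split=> u v; first by rewrite !permM t1 s1.
by move=> uv; rewrite !permM t2 ?s1 // s2.
Qed.

Canonical rot_aut_group := group rot_aut_group_set.

Hypothesis Q3 : 2 < #|Q|.
Hypothesis rho_adj : forall u v, hamming_adj u v -> hamming_adj u (rho u v).
Hypothesis rho_cycle : forall u v w, hamming_adj u v -> hamming_adj u w ->
  exists k, w = iter k (rho u) v.
Hypothesis arc_transitive : forall u v u' v',
  hamming_adj u v -> hamming_adj u' v' ->
  exists s, [/\ s \in rot_aut, s u = u' & s v = v'].

Lemma rot_aut_directions s : s \in rot_aut -> exists sg, directions s sg.
Proof. by case/rot_autP=> s_adj _; exact: automorphism_directions. Qed.

Lemma rot_aut_iter s u v k : s \in rot_aut -> hamming_adj u v ->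
  s (iter k (rho u) v) = iter k (rho (s u)) (s v).
Proof.
move=> /rot_autP[_ sR] uv; elim: k => //= k <-; rewrite sR //.
by elim: k => //= k; exact: rho_adj.
Qed.

(* A map automorphism fixing an arc fixes every arc at its source, hence
   everything by connectedness. *)
Lemma rot_aut_free s u v :
  s \in rot_aut -> hamming_adj u v -> s u = u -> s v = v -> s = 1.
Proof.
move=> As uv su sv.
pose fixes u := s u = u /\ forall v, hamming_adj u v -> s v = v.
have fix_adj w z : s w = w -> s z = z -> hamming_adj w z -> fixes w.
  move=> sw sz wz; split=> // z' wz'; have [k ->] := rho_cycle wz wz'.
  by rewrite rot_aut_iter // sw sz.
suff all w : fixes w by apply/permP => w; rewrite perm1; case: (all w).
apply: (subst_ind (P := fixes) (u := u)); first exact: fix_adj uv.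
move=> w' i _ [sw' adjw']; have [wi|wi] := eqVneq (w i) (w' i).
  rewrite wi (_ : subst _ _ _ = w') //.
  by apply/ffunP => l; rewrite ffunE; case: eqP => // ->.
have ww := differ_at_adj (differ_at_subst wi).
by apply: (fix_adj _ w') => //; [exact: adjw' | rewrite hamming_adj_sym].
Qed.

Variables (u0 v0 : W) (i0 : 'I_d).
Hypothesis uv0 : differ_at i0 u0 v0.
Let adj0 := differ_at_adj uv0.

(** Take an automorphism sending the arc from [u0] to [v0] to its successor. It commutes with the
    rotation, which is a single cycle at [u0], so it agrees with it on all neighbours. *)
Lemma rot_generator : exists x, [/\ x \in rot_aut, x u0 = u0
  & forall v, hamming_adj u0 v -> x v = rho u0 v].
Proof.
have [x [Ax xu xv]] := arc_transitive adj0 (rho_adj adj0).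
exists x; split=> // v uv; have [k ->] := rho_cycle adj0 uv.
by rewrite rot_aut_iter // xu xv -iterSr.
Qed.

Variable x : {perm W}.
Hypotheses (Ax : x \in rot_aut) (xu : x u0 = u0).
Hypothesis xrho : forall v, hamming_adj u0 v -> x v = rho u0 v.

Lemma generatorX_base k : (x ^+ k) u0 = u0.
Proof. by elim: k => [|k IHk]; rewrite ?expg0 ?perm1 // expgSr permM IHk. Qed.

Lemma neighbour_powers v : hamming_adj u0 v -> exists k, v = (x ^+ k) v0.
Proof.
move=> uv; have [k ->] := rho_cycle adj0 uv; exists k.
rewrite permX; elim: k => //= k IHk; rewrite -IHk xrho //.
by elim: k {IHk} => //= k; exact: rho_adj.
Qed.

(** Some power of [x] agrees with [s] at [v0], and only the identity fixes an arc. *)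
Lemma stabilizer_powers s : s \in rot_aut -> s u0 = u0 -> exists k, s = x ^+ k.
Proof.
move=> As su; have /neighbour_powers[k sv] : hamming_adj u0 (s v0).
  by have [s_adj _] := rot_autP _ As; rewrite -{1}su s_adj.
exists k; apply/eqP; rewrite eq_mulgV1; apply/eqP.
apply: (rot_aut_free (u := u0) (v := v0)) => //.
- by rewrite groupMr ?groupV ?groupX.
- by rewrite permM su -{1}(generatorX_base k) permK.
- by rewrite permM sv permK.
Qed.

(** * The cyclic action on directions *)

Variable sx : {perm 'I_d}.
Hypothesis dx : directions x sx.

Lemma direction_powers i : exists k, i = (sx ^+ k) i0.
Proof.
have [a ai] := other_element Q3 (u0 i); have ua := differ_at_subst ai.
have [k vE] := neighbour_powers (differ_at_adj ua); exists k.
apply: (differ_at_inj ua); rewrite vE -{1}(generatorX_base k).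
by rewrite (directions_differ _ _ _ (directionsX k dx)).
Qed.

(** The powers of [sx] form an abelian group, transitive on the directions by [direction_powers];
    such a group acts freely. *)
Lemma dirX_fix1 k i : (sx ^+ k) i = i -> sx ^+ k = 1.
Proof.
move=> ski; apply/permP => j; rewrite perm1.
have [m iE] := direction_powers i; have [n jE] := direction_powers j.
have ji : j = (sx ^+ n * (sx ^+ m)^-1) i.
  by rewrite jE iE -permM mulgA -expgD addnC expgD mulgK.
have cm : commute (sx ^+ k) (sx ^+ n * (sx ^+ m)^-1).
  by apply: commuteM; [apply: commuteX2|apply: commuteV; apply: commuteX2].
by rewrite ji -permM -cm permM ski.
Qed.

Lemma card_porbit_dir : #|porbit sx i0| = d.
Proof.
rewrite -[RHS]card_ord; apply: eq_card => i; rewrite inE.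
by have [k ->] := direction_powers i; rewrite mem_porbit.
Qed.

Lemma dirXd : sx ^+ d = 1.
Proof.
apply: (dirX_fix1 (i := i0)); rewrite permX.
by have := iter_porbit sx i0; rewrite card_porbit_dir.
Qed.

Lemma dirX_inj (k l : 'I_d) : (sx ^+ k) i0 = (sx ^+ l) i0 -> k = l.
Proof.
have U := uniq_traject_porbit sx i0; rewrite card_porbit_dir in U.
rewrite !permX => E; apply/val_inj/eqP => /=.
rewrite -(nth_uniq i0 _ _ U) ?size_traject //.
by rewrite !nth_traject // E.
Qed.

Lemma dirX_onto i : exists k : 'I_d, i = (sx ^+ k) i0.
Proof.
have : i \in porbit sx i0 by have [k ->] := direction_powers i; rewrite mem_porbit.
rewrite porbit_traject card_porbit_dir => /trajectP[k kd ->].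
by exists (Ordinal kd); rewrite permX.
Qed.

Lemma dirX_dvd k : sx ^+ k = 1 -> d %| k.
Proof.
have d0 : 0 < d by exact: leq_ltn_trans (ltn_ord i0).
rewrite {1}(divn_eq k d) mulnC expgD expgM dirXd expg1n mul1g => sk.
have := @dirX_inj (Ordinal (ltn_pmod k d0)) (Ordinal d0).
by rewrite /= sk expg0 => /(_ erefl) /(congr1 val) /= /eqP.
Qed.

Lemma stabilizer_directions s i : s \in rot_aut -> s u0 = u0 ->
  (forall v, differ_at i u0 v -> differ_at i u0 (s v)) -> directions s 1.
Proof.
move=> As su H; have [k sE] := stabilizer_powers As su.
have ds := directionsX k dx; rewrite sE.
have [a ai] := other_element Q3 (u0 i); have ua := differ_at_subst ai.
rewrite -[X in directions _ X](@dirX_fix1 k i) //.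
apply: differ_at_inj (H _ ua); rewrite sE -{1}(generatorX_base k).
by rewrite (directions_differ _ _ _ ds).
Qed.

(** * The stabiliser of a line *)

Definition line : {set W} := [set u | (u == u0) || differ_at i0 u0 u].

Lemma u0_line : u0 \in line. Proof. by rewrite inE eqxx. Qed.

(** Any point of the line can serve as its base point, since the line consists of the vertices that
    agree with [u0] off [i0]. *)
Lemma in_line u w : u \in line -> (w \in line) = (w == u) || differ_at i0 u w.
Proof.
have lineP (z : W) : reflect (forall j, j != i0 -> u0 j = z j) (z \in line).
  rewrite inE; apply: (iffP orP) => [[/eqP-> //|/differ_atP[] //]|zj].
  have [z0|z0] := eqVneq (u0 i0) (z i0); [left|right; apply/differ_atP; split=> //; exact/eqP].
  by apply/eqP/ffunP => j; have [->|/zj] := eqVneq j i0.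
move=> /lineP uL; apply/lineP/orP => [wL|[/eqP-> //|/differ_atP[_ uw] j ji]].
  have [z0|z0] := eqVneq (u i0) (w i0).
    by left; apply/eqP/ffunP => j; have [->|ji] := eqVneq j i0; rewrite // -uL ?wL.
  by right; apply/differ_atP; split=> [|j ji]; [exact/eqP | rewrite -uL ?wL].
by rewrite -uw ?uL.
Qed.

Lemma line_differ u w : u \in line -> w \in line -> u != w -> differ_at i0 u w.
Proof. by move=> uL; rewrite (in_line w uL) eq_sym => /orP[->|]. Qed.

Lemma card_line : #|line| = #|Q|.
Proof.
rewrite -(card_imset predT (f := subst u0 i0)); last first.
  by move=> a b /ffunP/(_ i0); rewrite !subst_eq.
apply: eq_card => u; rewrite [in LHS]inE; apply/orP/imsetP => [uL|[a _ ->]].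
  exists (u i0) => //; case: uL => [/eqP->|/differ_atE //].
  by apply/ffunP => j; rewrite ffunE; case: eqP => // ->.
have [->|au] := eqVneq a (u0 i0); last by right; exact: differ_at_subst.
by left; apply/eqP/ffunP => j; rewrite ffunE; case: eqP => // ->.
Qed.

Definition line_stab := 'N_rot_aut(line | 'P).
Definition base_stab := 'C_line_stab[u0 | 'P].
Canonical line_stab_group := [group of line_stab].
Canonical base_stab_group := [group of base_stab].

Lemma line_stabP s : reflect
  (s \in rot_aut /\ forall u, (s u \in line) = (u \in line)) (s \in line_stab).
Proof.
apply: (iffP setIP) => -[As /=]; first by move=> Ns; split=> // u; exact: (astabs_act u Ns).
move=> sL; split=> //; rewrite !inE; apply/andP; split=> //.
by apply/subsetP => u uL; rewrite inE /= apermE sL.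
Qed.

Lemma base_stabP s : reflect (s \in line_stab /\ s u0 = u0) (s \in base_stab).
Proof.
apply: (iffP setIP) => -[Ss su]; split=> //.
  by move/astab1P: su.
by apply/astab1P.
Qed.

(** Arc-transitivity provides [s]; it maps an edge of direction [i0] on the line to another such
    edge, so it fixes this direction and preserves the line. *)
Lemma line_stab_transitive u v u' v' : u \in line -> v \in line -> u != v ->
  u' \in line -> v' \in line -> u' != v' ->
  exists s, [/\ s \in line_stab, s u = u' & s v = v'].
Proof.
move=> uL vL uv u'L v'L uv'.
have [duv duv'] := (line_differ uL vL uv, line_differ u'L v'L uv').
have [s [As su sv]] := arc_transitive (differ_at_adj duv) (differ_at_adj duv').
exists s; split=> //; apply/line_stabP; split=> // w.
have [sg ds] := rot_aut_directions As.
have sgi : sg i0 = i0.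
  by apply: differ_at_inj duv'; rewrite -su -sv (directions_differ _ _ _ ds).
rewrite (in_line w uL) -su in u'L *; rewrite (in_line _ u'L) (inj_eq perm_inj).
by rewrite -{1}sgi (directions_differ _ _ _ ds).
Qed.

Lemma base_stab_directions s : s \in base_stab -> directions s 1.
Proof.
case/base_stabP=> /line_stabP[As sL] su; apply: (stabilizer_directions (i := i0)) => // v uv.
have vL : v \in line by rewrite inE uv orbT.
apply: line_differ; rewrite ?u0_line ?sL // -{1}su (inj_eq perm_inj).
by apply: contraTneq uv => <-; apply/negP => /differ_atP[].
Qed.

Lemma third_on_line u v : u \in line -> v \in line ->
  exists w, [/\ w \in line, w != u & w != v].
Proof.
move=> uL vL; have : 0 < #|line :\: [set u; v]|.
  have := cardsID [set u; v] line; rewrite card_line => cE.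
  rewrite -(ltn_add2l #|line :&: [set u; v]|) addn0 cE.
  apply: leq_ltn_trans (subset_leq_card (subsetIr _ _)) _.
  by rewrite cards2; apply: leq_trans Q3; case: eqP.
case/card_gt0P=> w; rewrite !inE negb_or => /andP[/andP[wu wv] wL].
by exists w; rewrite inE wL wu wv.
Qed.

(* The line stabiliser is generated by its point stabilisers: as q > 2, any
   point of the line is sent to any other by the stabiliser of a third one. *)
Lemma line_stab_directions s : s \in line_stab -> directions s 1.
Proof.
(* The case of a fixed point [u] reduces to [u0] by conjugation with some [g] taking [u0] to [u];
   whatever [g] does to the directions cancels. *)
have pt r u : r \in line_stab -> u \in line -> r u = u -> directions r 1.
  move=> Sr uL ru; have [uu0|uu0] := eqVneq u u0.
    by apply: base_stab_directions; apply/base_stabP; rewrite -uu0.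
  have [w [wL wu wu0]] := third_on_line uL u0_line.
  have u0w : u0 != w by rewrite eq_sym.
  have uw : u != w by rewrite eq_sym.
  have [g [Sg gu _]] := line_stab_transitive u0_line wL u0w uL wL uw.
  have [|sg dg] := rot_aut_directions (s := g); first by case/line_stabP: Sg.
  have dr : directions (r ^ g^-1) 1.
    apply: base_stab_directions; apply/base_stabP; split; first by rewrite groupJ ?groupV.
    by rewrite conjgE invgK !permM gu ru -gu permK.
  have := directionsM (directionsV dg) (directionsM dr dg).
  by rewrite -conjgE conjgKV mul1g mulVg.
move=> Ss; have sL : s u0 \in line by case/line_stabP: Ss => _ ->; exact: u0_line.
have [su|su] := eqVneq (s u0) u0; first exact: pt u0_line su.
have [w [wL wu wu0]] := third_on_line sL u0_line.
have [r [Sr rw ru]] := line_stab_transitive wL u0_line wu0 wL sL wu.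
rewrite -(mulgKV r s) -[1](mulg1 1); apply: directionsM; last exact: pt rw.
by apply: (pt _ u0); rewrite ?u0_line ?groupM ?groupV // permM -ru permK.
Qed.

Lemma line_stab_free s u v : s \in line_stab -> u \in line -> v \in line -> u != v ->
  s u = u -> s v = v -> s = 1.
Proof.
move=> /line_stabP[As _] uL vL uv; apply: rot_aut_free => //.
exact: differ_at_adj (line_differ uL vL uv).
Qed.

Lemma v0_line : v0 \in line. Proof. by rewrite inE uv0 orbT. Qed.

Lemma u0_neq_v0 : u0 != v0.
Proof. by apply: contraTneq uv0 => <-; apply/negP => /differ_atP[]. Qed.

Lemma line_stab_atrans : [transitive line_stab, on line | 'P].
Proof.
apply/imsetP; exists u0; first exact: u0_line.
apply/setP => u; apply/idP/orbitP => [uL|[s Ss <-]]; last first.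
  by case/line_stabP: Ss => _ sL; rewrite /= apermE sL u0_line.
have [->|uu0] := eqVneq u u0; first by exists 1; rewrite ?group1 //= apermE perm1.
have u0u : u0 != u by rewrite eq_sym.
have [s [Ss su _]] := line_stab_transitive u0_line uL u0u uL u0_line uu0.
by exists s.
Qed.

(** The action on the line is transitive and only the identity fixes two points. The complement is
    nontrivial because q > 2: some element fixes [u0] and moves [v0] to a third point. *)
Lemma line_stab_Frobenius : [Frobenius line_stab with complement base_stab].
Proof.
apply/Frobenius_actionP; exists _ line 'P%act; split.
- apply/subsetP => s /setIP[Ss /astabP sL]; rewrite inE; apply/eqP.
  apply: (line_stab_free Ss u0_line v0_line u0_neq_v0); apply: sL.
    exact: u0_line.
  exact: v0_line.
- exact: line_stab_atrans.
- move=> s /setD1P[s1 Ss]; rewrite leqNgt; apply: contra s1 => /card_gt1P[u [v [uF vF uv]]].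
  have /setIP[uL /afix1P su] := uF; have /setIP[vL /afix1P sv] := vF.
  by apply/eqP; exact: (line_stab_free Ss uL vL uv su sv).
- have [w [wL wu0 wv0]] := third_on_line u0_line v0_line.
  have u0w : u0 != w by rewrite eq_sym.
  have [s [Ss su sv]] := line_stab_transitive u0_line v0_line u0_neq_v0 u0_line wL u0w.
  apply: contra_neq wv0 => H1; rewrite -sv.
  have : s \in base_stab by apply/base_stabP.
  by rewrite H1 inE => /eqP->; rewrite perm1.
- by exists u0; rewrite ?u0_line.
Qed.

Lemma line_kernel : exists (p : nat) (K : {group {perm W}}),
  [/\ prime p, p.-abelem K, #|K| = #|Q|, [Frobenius line_stab = K ><| base_stab]
    & forall t1 t2, t1 \in K -> t1 != 1 -> t2 \in K -> t2 != 1 ->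
        exists2 h, h \in base_stab & t2 = t1 ^ h].
Proof.
have [K frobK] := Frobenius_kernel_exists line_stab_Frobenius.
have /andP[/eqP defS _] := frobK.
have [nKS sHS _ nKH tiKH] := sdprod_context defS.
have cardK : #|K| = #|Q|.
  apply/eqP; rewrite -(eqn_pmul2r (cardG_gt0 base_stab_group)) (sdprod_card defS).
  rewrite -card_line -(atransP line_stab_atrans _ u0_line) card_orbit mulnC.
  by rewrite Lagrange ?subsetIl.
have sKS : K \subset line_stab by case/andP: nKS.
have moves t : t \in K -> t != 1 -> t u0 \in line /\ t u0 != u0.
  move=> Kt t1; have St := subsetP sKS _ Kt; split.
    by case/line_stabP: (St) => _ ->; exact: u0_line.
  apply: contra t1 => /eqP tu0; rewrite -in_set1 -[[set 1]]tiKH inE Kt.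
  exact/base_stabP.
(* Choose [h] fixing [u0] and taking [t1 u0] to [t2 u0]. Then [t1 ^ h] and [t2] agree at [u0], and
   their quotient lies in the trivial intersection of [K] and [base_stab]. *)
have conjK t1 t2 : t1 \in K -> t1 != 1 -> t2 \in K -> t2 != 1 ->
    exists2 h, h \in base_stab & t2 = t1 ^ h.
  move=> Kt1 nt1 Kt2 nt2; have [t1L t1u] := moves _ Kt1 nt1; have [t2L t2u] := moves _ Kt2 nt2.
  have [h [Sh ht hu]] := line_stab_transitive t1L u0_line t1u t2L u0_line t2u.
  have Hh : h \in base_stab by apply/base_stabP.
  exists h => //; apply/eqP; rewrite eq_mulgV1 -in_set1 -[[set 1]]tiKH inE.
  have Kt : t2 * (t1 ^ h)^-1 \in K by rewrite groupM ?groupV // memJ_norm // (subsetP nKH).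
  rewrite Kt /=; apply/base_stabP; split; first exact: (subsetP sKS).
  by rewrite permM -ht; apply: (canLR (permK _)); rewrite conjgE !permM -{2}hu permK.
have ntK : K :!=: 1 by rewrite -cardG_gt1 cardK (ltn_trans _ Q3).
have p_pr : prime (pdiv #|K|) by rewrite pdiv_prime // cardG_gt1.
set p := pdiv #|K| in p_pr.
have [t Kt ordt] := Cauchy p_pr (pdiv_dvd _).
have t1 : t != 1 by rewrite -order_gt1 ordt prime_gt1.
(* All nontrivial elements are conjugate to [t], so they have the same prime order. *)
have ordK s : s \in K -> s != 1 -> #[s] = p.
  by move=> Ks s1; have [h _ ->] := conjK t s Kt t1 Ks s1; rewrite orderJ.
have pK : p.-group K.
  apply/pgroupP => r r_pr /(Cauchy r_pr)[s Ks ords].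
  by rewrite inE -ords ordK // -order_gt1 ords prime_gt1.
(* The centre of the p-group [K] is nontrivial and invariant under [base_stab], so it contains every
   conjugate of a nontrivial central element, that is, all of [K]. *)
have abK : abelian K.
  have : 'Z(K) != 1 by rewrite center_nil_eq1 ?(pgroup_nil pK).
  case/trivgPn=> z Zz z1; apply/center_idP/eqP; rewrite eqEsubset center_sub /=.
  apply/subsetP => s Ks; have [->|s1] := eqVneq s 1; first exact: group1.
  have [h Hh ->] := conjK z s (subsetP (center_sub K) _ Zz) z1 Ks s1.
  by rewrite memJ_norm // (subsetP (char_norm_trans (center_char K) nKH)).
exists p, K; split=> //; apply/abelemP => //; split=> // s Ks.
have [->|s1] := eqVneq s 1; first by rewrite expg1n.
by rewrite -(ordK s) // expg_order.
Qed.

(** * The Frobenius kernel of the line stabiliser *)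

Section Kernel.
Variables (p : nat) (K : {group {perm W}}).
Hypotheses (p_pr : prime p) (abelK : p.-abelem K) (cardK : #|K| = #|Q|).
Hypothesis frobK : [Frobenius line_stab = K ><| base_stab].
Hypothesis conjK : forall t1 t2, t1 \in K -> t1 != 1 -> t2 \in K -> t2 != 1 ->
  exists2 h, h \in base_stab & t2 = t1 ^ h.

Lemma kernel_sub : K \subset line_stab.
Proof. by have [/andP[/eqP/sdprod_context[/andP[]]]] := (frobK). Qed.

(* The stabiliser in [line_stab] of a value c of coordinate j complements
   [base_stab], so it is a subgroup of the order of the normal Hall subgroup K. *)
Lemma kernel_moves_one t w j : t \in K -> j != i0 -> t w j = w j.
Proof.
move=> Kt ji; have /andP[/eqP defS _] := frobK.
have [nKS sHS _ nKH tiKH] := sdprod_context defS.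
have St := subsetP kernel_sub _ Kt; have dt := line_stab_directions St.
have keep0 s : s \in line_stab -> s u0 j = u0 j.
  case/line_stabP=> _ sL; have := sL u0; rewrite u0_line inE => /orP[/eqP-> //|].
  by case/differ_atP=> _ ->.
have [wj|wj] := eqVneq (w j) (u0 j).
  by apply/eqP; rewrite wj -(keep0 _ St) (directions_id dt) wj.
(* As [line_stab] acts trivially on directions, the image of the value [w j] can be tested on any
   vertex having it. The vertex [wc] is adjacent to [u0], so freeness on arcs applies. *)
pose wc := subst u0 j (w j).
pose B := [set s in line_stab | s wc j == w j].
have BE s : s \in line_stab -> (s \in B) = (s wc j == wc j).
  by move=> Ss; rewrite inE Ss subst_eq.
have gB : group_set B.
  apply/group_setP; split=> [|r s]; first by rewrite BE ?group1 // perm1.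
  move=> /setIdP[Sr /eqP rw] /setIdP[Ss /eqP sw]; rewrite inE groupM //= permM -sw.
  by rewrite (directions_id (line_stab_directions Ss)) rw subst_eq.
have d_wc : differ_at j u0 wc by exact: differ_at_subst.
have tiBH : B :&: base_stab = 1.
  apply/eqP; rewrite -[B]/(gval (group gB)) -subG1; apply/subsetP => s.
  case/setIP=> /setIdP[Ss /eqP sw] /base_stabP[_ su].
  rewrite inE; apply/eqP; apply: (rot_aut_free _ (differ_at_adj d_wc)) => //.
    by case/line_stabP: Ss.
  have : differ_at j u0 (s wc).
    by rewrite -su -{1}[j](perm1 j) (directions_differ _ _ _ (line_stab_directions Ss)).
  by move/differ_atE=> ->; rewrite sw.
have defBH : B * base_stab = line_stab.
  apply/eqP; rewrite eqEsubset mul_subG //=; last by apply/subsetP => s /setIdP[].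
  apply/subsetP => s Ss; have ds := line_stab_directions Ss.
  have sc : s wc j != u0 j.
    by rewrite -(keep0 _ Ss) (directions_id ds) subst_eq.
  pose wd := subst u0 j (s wc j).
  have d_wd : differ_at j u0 wd by exact: differ_at_subst.
  (* This [h] fixes [u0] and brings the value [s wc j] back to [w j]. It fixes direction [j], hence
     all directions and the line, so [h] is in [base_stab] and [s * h] in [B]. *)
  have [h [Ah hu hw]] := arc_transitive (differ_at_adj d_wd) (differ_at_adj d_wc).
  have [k hE] := stabilizer_powers Ah hu.
  have dh : directions h 1.
    have dk := directionsX k dx; rewrite hE -(dirX_fix1 (k := k) (i := j)) //.
    by apply: differ_at_inj d_wc; rewrite -{1}hu -hw hE (directions_differ _ _ _ dk).
  have Hh : h \in base_stab.
    apply/base_stabP; split=> //; apply/line_stabP; split=> // u.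
    rewrite ![in LHS]inE -{1 2}hu (inj_eq perm_inj) -{1}[i0](perm1 i0).
    by rewrite (directions_differ _ _ _ dh) inE.
  have Sh : h \in line_stab by case/base_stabP: Hh.
  apply/mulsgP; exists (s * h) h^-1; rewrite ?groupV ?mulgK //.
  rewrite inE groupM //= permM -[X in _ == X](subst_eq u0 j) -/wc -[in X in _ == X]hw.
  by rewrite (directions_id dh) subst_eq.
have cardB : #|B| = #|K|.
  have cBH : #|line_stab| = (#|B| * #|base_stab|)%N.
    by rewrite -[in LHS]defBH (TI_cardMg (G := group gB) (H := base_stab_group)).
  by apply/eqP; rewrite -(eqn_pmul2r (cardG_gt0 base_stab_group)) -cBH (sdprod_card defS).
have hallK : p.-Hall(line_stab) K.
  rewrite /pHall kernel_sub (abelem_pgroup abelK) /=.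
  rewrite -divgS ?kernel_sub // -(sdprod_card defS) mulKn ?cardG_gt0 //.
  rewrite p'natE // -prime_coprime //; apply: coprime_dvdl (Frobenius_coprime frobK).
  have ntK : K :!=: 1 by rewrite -cardG_gt1 cardK (ltn_trans _ Q3).
  by have [] := pgroup_pdiv (abelem_pgroup abelK) ntK.
(* A p-subgroup lies in the normal Hall p-subgroup; equality follows from the orders. *)
have sBK : B \subset K.
  rewrite (sub_normal_Hall hallK nKS (K := group gB)); last by apply/subsetP => s /setIdP[].
  by rewrite /pgroup cardB; exact: abelem_pgroup abelK.
have /eqP BK : B == K :> {set _} by rewrite eqEcard sBK cardB leqnn.
have : t \in B by rewrite BK.
rewrite inE => /andP[_ /eqP tw]; apply/eqP; rewrite -{1}tw.
by rewrite (directions_id dt) subst_eq.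
Qed.

Lemma xd_base_stab : x ^+ d \in base_stab.
Proof.
have dc : directions (x ^+ d) 1 by rewrite -dirXd; exact: directionsX.
apply/base_stabP; split; last exact: generatorX_base.
apply/line_stabP; split=> [|u]; first by rewrite groupX.
rewrite ![in LHS]inE -{1 2}(generatorX_base d) (inj_eq perm_inj) -{1}[i0](perm1 i0).
by rewrite (directions_differ _ _ _ dc) inE.
Qed.

(** Such an [h] is a power of [x] acting trivially on directions, and [sx] has order [d]. *)
Lemma base_stab_powers h : h \in base_stab -> exists m, h = (x ^+ d) ^+ m.
Proof.
move=> Hh; have dh := base_stab_directions Hh.
have [Sh hu] := base_stabP _ Hh; have [Ah _] := line_stabP _ Sh.
have [k hE] := stabilizer_powers Ah hu; have dk := directionsX k dx.
have : sx ^+ k = 1.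
  apply: (dirX_fix1 (i := i0)); apply: (differ_at_inj (u := u0) (v := h v0)).
    by rewrite -hu hE (directions_differ _ _ _ dk).
  by rewrite -{1}hu -{1}[i0](perm1 i0) (directions_differ _ _ _ dh).
by move/dirX_dvd/dvdnP=> [m kE]; exists m; rewrite -expgM mulnC -kE.
Qed.

(** Elements of [K] move [u0] only in coordinate [i0], and [K] meets [base_stab] trivially, so the
    value there determines the element; counting gives surjectivity. The boolean form suits
    [xchoose]. *)
Lemma kernel_onto a : exists t, (t \in K) && (t u0 i0 == a).
Proof.
have /andP[/eqP defS _] := frobK.
have [_ _ _ _ tiKH] := sdprod_context defS.
have inj : {in K &, injective (fun t : {perm W} => t u0 i0)}.
  move=> s t Ks Kt /= st.
  have eq_st : s u0 = t u0.
    apply/ffunP => j; have [->//|ji] := eqVneq j i0.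
    by rewrite !kernel_moves_one.
  apply/eqP; rewrite eq_mulgV1 -in_set1 -[[set 1]]tiKH inE groupM ?groupV //=.
  apply/base_stabP; split; last by rewrite permM eq_st permK.
  by rewrite groupM ?groupV // (subsetP kernel_sub).
have /setP/(_ a) : [set t u0 i0 | t : {perm W} in K] = [set: Q].
  by apply/eqP; rewrite eqEcard subsetT cardsT card_in_imset // cardK leqnn.
by rewrite inE => /imsetP[t Kt ->]; exists t; rewrite Kt eqxx.
Qed.

Import GRing.Theory.
Local Open Scope ring_scope.

(** * Coordinates over a field of order q *)

Section Coordinates.
Variables (F : finFieldType) (w : F) (th : {perm W} -> F).
Hypothesis cardF : #|F| = #|K|.
Hypothesis thM : {in K &, {morph th : a b / (a * b)%g >-> a + b}}.
Hypothesis th_inj : {in K &, injective th}.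
Hypothesis thJ : {in K, forall a, th (a ^ (x ^+ d))%g = w * th a}.

Let th1 : th 1%g = 0.
Proof. by apply: (addrI (th 1%g)); rewrite -thM ?group1 // mulg1 addr0. Qed.

Lemma th_onto l : exists2 t, t \in K & th t = l.
Proof.
have /setP/(_ l) : th @: K = [set: F].
  by apply/eqP; rewrite eqEcard subsetT cardsT card_in_imset // cardF leqnn.
by rewrite inE => /imsetP[t Kt ->]; exists t.
Qed.

Let tr a := xchoose (kernel_onto a).
Let trK a : tr a \in K. Proof. by case/andP: (xchooseP (kernel_onto a)). Qed.
Let trE a : tr a u0 i0 = a.
Proof. by case/andP: (xchooseP (kernel_onto a)) => _ /eqP. Qed.

(** Identifies [Q] with [F] through the regular action of [K] on the line, with [u0 i0] as
    origin. *)
Definition label a := th (tr a).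

Lemma label_inj : injective label.
Proof. by move=> a b /(th_inj (trK a) (trK b)) ab; rewrite -(trE a) ab trE. Qed.

Lemma labelE t : t \in K -> label (t u0 i0) = th t.
Proof.
move=> Kt; congr th; have /andP[/eqP defS _] := frobK.
have [_ _ _ _ tiKH] := sdprod_context defS; set r := tr _.
have Kr : r \in K by exact: trK.
have eq_rt : r u0 = t u0.
  apply/ffunP => j; have [->|ji] := eqVneq j i0; first exact: trE.
  by rewrite !kernel_moves_one.
apply/eqP; rewrite eq_mulgV1 -in_set1 -[[set 1%g]]tiKH inE groupM ?groupV //=.
apply/base_stabP; split; last by rewrite permM eq_rt permK.
by rewrite groupM ?groupV // (subsetP kernel_sub).
Qed.

Lemma label_u0 : label (u0 i0) = 0.
Proof. by have := labelE (group1 K); rewrite perm1 th1. Qed.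

(** Since [t] acts trivially on directions, [t v i0] depends only on [v i0], so [v] may be replaced
    by the image of [u0] under [tr (v i0)]. *)
Lemma label_kernel t v : t \in K -> label (t v i0) = label (v i0) + th t.
Proof.
move=> Kt; have dt := line_stab_directions (subsetP kernel_sub _ Kt).
have -> : t v i0 = (tr (v i0) * t)%g u0 i0.
  by apply/eqP; rewrite permM (directions_id dt) trE.
by rewrite labelE ?groupM // thM.
Qed.

(** As [x ^+ d] fixes [u0], its action on the line becomes conjugation on [K]. *)
Lemma label_xd v : label ((x ^+ d)%g v i0) = w * label (v i0).
Proof.
have Hc := xd_base_stab; have dc := base_stab_directions Hc.
have nKc : (x ^+ d)%g \in 'N(K)%g.
  have /andP[/eqP defS _] := frobK.
  by have [_ _ _ nKH _] := sdprod_context defS; exact: (subsetP nKH).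
have -> : (x ^+ d)%g v i0 = (tr (v i0) ^ (x ^+ d))%g u0 i0.
  apply/eqP; rewrite conjgE !permM -{1}(generatorX_base d) permK.
  by rewrite (directions_id dc) trE.
by rewrite labelE ?memJ_norm // thJ.
Qed.

(** Entry [k] reads the coordinate of [v] in direction [(sx ^+ k) i0], brought back to [i0] by a
    power of [x]; this makes [x] a shift of the entries. *)
Definition coords v : 'rV[F]_d := \row_(k < d) label ((x ^- k)%g v i0).

Lemma coords_eq u v (k : 'I_d) :
  (coords u 0 k == coords v 0 k) = (u ((sx ^+ k)%g i0) == v ((sx ^+ k)%g i0)).
Proof.
rewrite !mxE (inj_eq label_inj) -[LHS](directionsX k dx).
by rewrite !permKV.
Qed.

Lemma coords_inj : injective coords.
Proof.
move=> u v uv; apply/ffunP => i; have [k ->] := dirX_onto i.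
by apply/eqP; rewrite -coords_eq uv.
Qed.

Lemma coords_u0 : coords u0 = 0.
Proof.
apply/rowP => k; rewrite !mxE; have -> : (x ^- k)%g u0 = u0.
  by rewrite -{1}(generatorX_base k) permK.
exact: label_u0.
Qed.

Lemma coords_adj u v : hamming_adj u v = (coords v - coords u \in hamming_conn d F).
Proof.
have subE j : (coords v - coords u) 0 j = coords v 0 j - coords u 0 j.
  by rewrite [LHS]mxE; congr (_ + _); exact: mxE.
apply/hamming_adjP/hamming_connP => [[i]|[l [k [l0 lE]]]].
  have [k ->] := dirX_onto i => /differ_atP[uk uj].
  exists ((coords v - coords u) 0 k), k; split.
    by rewrite subE subr_eq0 coords_eq eq_sym; exact/eqP.
  apply/rowP => j; rewrite [RHS]mxE [delta_mx _ _ _ _]mxE eqxx /=.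
  have [->|jk] := eqVneq j k; first by rewrite mulr1.
  rewrite mulr0; apply/eqP; rewrite subE subr_eq0 coords_eq eq_sym uj //.
  by apply: contra_neq jk; exact: dirX_inj.
exists ((sx ^+ k)%g i0); apply/differ_atP.
have lj j : (v ((sx ^+ j)%g i0) == u ((sx ^+ j)%g i0)) = (l * (j == k)%:R == 0).
  rewrite -coords_eq -subr_eq0.
  by have /rowP/(_ j) := lE; rewrite subE ![in RHS]mxE eqxx => ->.
split=> [/esym/eqP|i]; first by rewrite lj eqxx mulr1 (negPf l0).
have [j -> jk] := dirX_onto i; apply/esym/eqP; rewrite lj.
by rewrite (_ : (j == k) = false) ?mulr0 ?eqxx //; apply: contraNF jk => /eqP->.
Qed.

(** Entry [j.+1] of the image is entry [j] of [v]. At the wrap-around [x] equals [x ^+ d] after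
    [x ^- d.-1], whence the factor [w]. *)
Lemma coords_x v : coords (x v) = coords v *m hamming_mx d w.
Proof.
have d0 : (0 < d)%N by exact: leq_ltn_trans (ltn_ord i0).
apply/rowP => j; rewrite [LHS]mxE [RHS]mxE.
case: j => -[|j] ltjd /=.
  have ltd : (d.-1 < d)%N by rewrite prednK.
  rewrite (bigD1 (Ordinal ltd)) //= big1 ?addr0 => [|k kd].
    rewrite !mxE /= expg0 invg1 perm1 prednK // eqxx mulrC -label_xd; congr (label (_ i0)).
    have -> : (x ^+ d = x ^+ d.-1 * x)%g by rewrite -expgSr prednK.
    by rewrite permM permKV.
  rewrite !mxE /= andbT; case: eqP => [kE|]; last by rewrite mulr0.
  by case/eqP: kd; apply: val_inj; exact: (congr1 predn kE).
have ltj : (j < d)%N by exact: ltnW.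
rewrite (bigD1 (Ordinal ltj)) //= big1 ?addr0 => [|k kj].
  by rewrite !mxE /= eqxx mulr1 expgSr invMg permM permK.
rewrite !mxE /= eqSS andbF eq_sym -[j]/(val (Ordinal ltj)) (inj_eq val_inj) (negPf kj).
by rewrite mulr0.
Qed.

(** It suffices to translate by multiples of basis vectors: conjugating an element of [K] by
    [x ^+ k] gives a translation in entry [k] alone. *)
Lemma coords_translation (a : 'rV[F]_d) :
  exists2 t, t \in rot_aut & forall v, coords (t v) = coords v + a.
Proof.
rewrite [a]row_sum_delta.
elim/big_ind: _ => [|b c [s As sE] [t At tE]|k _].
- by exists 1%g => [|v]; rewrite ?group1 // perm1 addr0.
- by exists (s * t)%g => [|v]; rewrite ?groupM // permM tE sE addrA.
have [t Kt <-] := th_onto (a 0 k).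
have St := subsetP kernel_sub _ Kt.
exists (t ^ (x ^+ k))%g => [|v].
  by rewrite groupJ ?groupX //; case/line_stabP: St.
apply/rowP => j.
have -> : (coords v + th t *: delta_mx 0 k) 0 j = coords v 0 j + th t * (j == k)%:R.
  by rewrite [LHS]mxE; congr (_ + _); rewrite [LHS]mxE [delta_mx _ _ _ _]mxE eqxx.
have [->|jk] := eqVneq j k.
  by rewrite mulr1 !mxE conjgE !permM permK label_kernel.
rewrite mulr0 addr0; apply/eqP; rewrite coords_eq.
rewrite -[(sx ^+ j)%g i0](permKV (sx ^+ k)%g) -{2}[v](permKV (x ^+ k)%g).
rewrite conjgE !permM (directionsX k dx) kernel_moves_one //.
apply: contra_neq jk => jk; apply: dirX_inj.
by rewrite -[LHS](permKV (sx ^+ k)%g) jk.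
Qed.

(** A translation in [rot_aut] carries [u0] to [u] and respects the rotation, which at [u0] is
    [x]. *)
Lemma coords_rho u v : hamming_adj u v ->
  coords (rho u v) = coords u + (coords v - coords u) *m hamming_mx d w.
Proof.
have [t At tE] := coords_translation (coords u).
have tu : t u0 = u by apply: coords_inj; rewrite tE coords_u0 add0r.
have [t_adj t_rho] := rot_autP _ At.
rewrite -tu -[v](permKV t) t_adj => uv; rewrite t_rho // -xrho // !tE coords_u0 add0r.
by rewrite coords_x addrK addrC.
Qed.

End Coordinates.

Lemma coordinatisation (F : finFieldType) : #|F| = #|Q| ->
  exists (w : {unit F}) (f : W -> 'rV[F]_d),
    [/\ generator [set: {unit F}] w, injective f,
      forall u v, hamming_adj u v = (f v - f u \in hamming_conn d F)
    & forall u v, hamming_adj u v ->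
        f (rho u v) = f u + (f v - f u) *m hamming_mx d (val w)].
Proof.
move=> cardF; have cardFK : #|F| = #|K| by rewrite cardK.
have : K :!=: 1%g by rewrite -cardG_gt1 cardK (ltn_trans _ Q3).
case/trivgPn=> t1 Kt1 nt1.
have nKc : (x ^+ d)%g \in 'N(K)%g.
  have /andP[/eqP defS _] := frobK.
  have [_ _ _ nKH _] := sdprod_context defS; exact: (subsetP nKH) xd_base_stab.
have orb t : t \in K -> t != 1%g -> exists m, t = (t1 ^ ((x ^+ d) ^+ m))%g.
  move=> Kt nt; have [h /base_stab_powers[m ->] ->] := conjK Kt1 nt1 Kt nt.
  by exists m.
have [w [th [tht1 thM th_inj thJ]]] := abelem_field_model abelK nKc Kt1 nt1 orb cardFK.
have th1 : th 1%g = 0.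
  by apply: (addrI (th 1%g)); rewrite -thM ?group1 // mulg1 addr0.
have Uw : w \is a GRing.unit.
  rewrite unitfE; apply: contraNneq nt1 => w0; rewrite -(conjg_eq1 _ (x ^+ d)%g).
  by apply/eqP/th_inj; rewrite ?group1 ?memJ_norm // thJ // w0 mul0r th1.
have thX m : th (t1 ^ ((x ^+ d) ^+ m))%g = w ^+ m.
  elim: m => [|m IHm]; first by rewrite expg0 conjg1 expr0.
  have Kt : (t1 ^ ((x ^+ d) ^+ m))%g \in K by rewrite memJ_norm ?(groupX _ nKc).
  by rewrite expgSr conjgM thJ // IHm exprS.
exists (FinRing.unit F Uw), (coords th); split.
(* Each unit is [th t] for a nontrivial [t] in [K]; this [t] is conjugate to [t1] by a power of
   [x ^+ d], so its value is a power of [w]. *)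
- rewrite /generator eqEsubset subsetT andbT; apply/subsetP => l _.
  have [t Kt tE] := th_onto cardFK th_inj (val l).
  have nt : t != 1%g.
    apply: contraTneq (valP l) => t1E.
    by rewrite -tE t1E th1 unitr0.
  have [m tm] := orb t Kt nt; apply/cycleP; exists m; apply: val_inj.
  by rewrite FinRing.val_unitX /= -tE tm thX.
- exact: coords_inj.
- exact: coords_adj.
- exact: (coords_rho cardFK thM th_inj thJ).
Qed.

End Kernel.

End RotationAutomorphisms.

(** * Regular embeddings *)

Section RegularEmbedding.
Import GRing.Theory.
Local Open Scope ring_scope.
Variables (d : nat) (Q : finType) (M : oriented_map).
Local Notation W := {ffun 'I_d -> Q}.
Variables (f : vertex M -> W) (g : garc M -> garc (hamming_graph d Q)).
Hypothesis fg_iso : @is_graph_iso M (hamming_graph d Q) f g.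

Lemma embed_val x : val (g x) = (f (source x), f (target x)).
Proof.
case: fg_iso => _ _ srcE revE; rewrite [LHS]surjective_pairing; congr pair.
  exact: srcE.
by rewrite /target -srcE -revE.
Qed.

Lemma embed_adj x : hamming_adj (f (source x)) (f (target x)).
Proof. by have := valP (g x); rewrite embed_val. Qed.

Lemma embed_arc u v : hamming_adj u v ->
  exists x, f (source x) = u /\ f (target x) = v.
Proof.
move=> uv; have [_ [g' _ gK] _ _] := fg_iso.
pose P (p : W * W) := hamming_adj p.1 p.2.
exists (g' (exist P (u, v) uv)).
by have := embed_val (g' (exist P (u, v) uv)); rewrite gK => -[uE vE]; split.
Qed.

Lemma embed_arc_inj x y :
  f (source x) = f (source y) -> f (target x) = f (target y) -> x = y.
Proof.
move=> xy xy'; have [_ /bij_inj g_inj _ _] := fg_iso.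
by apply/g_inj/val_inj; rewrite !embed_val xy xy'.
Qed.

(** The rotation of [M] carried over to pairs of vertices. The arc picked is unique by
    [embed_arc_inj]; the default [v] concerns nonadjacent pairs only. *)
Definition next_neighbour (u v : W) : W :=
  if [pick x | (f (source x) == u) && (f (target x) == v)] is Some x
  then f (target (rotation M x)) else v.

Lemma next_neighbourE x :
  next_neighbour (f (source x)) (f (target x)) = f (target (rotation M x)).
Proof.
rewrite /next_neighbour; case: pickP => [y /andP[/eqP sy /eqP ty]|/(_ x)].
  by rewrite (embed_arc_inj sy ty).
by rewrite !eqxx.
Qed.

Lemma source_rotation x : source (rotation M x) = source x.
Proof.
by apply/esym/eqP; rewrite rotation_cycle; have := mem_porbit (rotation M) 1 x; rewrite expg1.
Qed.

Lemma next_neighbour_adj u v : hamming_adj u v -> hamming_adj u (next_neighbour u v).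
Proof.
case/embed_arc=> x [<- <-]; rewrite next_neighbourE -source_rotation.
exact: embed_adj.
Qed.

Lemma next_neighbour_cycle u v w : hamming_adj u v -> hamming_adj u w ->
  exists k, w = iter k (next_neighbour u) v.
Proof.
case/embed_arc=> x [<- <-] /embed_arc[y [yx <-]].
have [/bij_inj f_inj _ _ _] := fg_iso.
have : y \in porbit (rotation M) x by rewrite -rotation_cycle (f_inj _ _ yx).
case/porbitP=> k ->; exists k; rewrite permX.
have srcE n : source (iter n (rotation M) x) = source x.
  by elim: n => //= n IHn; rewrite source_rotation.
by elim: k => //= k <-; rewrite -{1}(srcE k) next_neighbourE.
Qed.

Lemma next_neighbour_transitive : orientably_regular M ->
  forall u v u' v', hamming_adj u v -> hamming_adj u' v' ->
  exists s, [/\ s \in rot_aut next_neighbour, s u = u' & s v = v'].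
Proof.
move=> regM u v u' v' /embed_arc[x [<- <-]] /embed_arc[y [<- <-]].
have [f' fK f'K] : bijective f by case: fg_iso.
have [a [b [[[bija bijb srcE revE] rotE] bx]]] := regM x y.
have tgtE z : target (b z) = a (target z) by rewrite /target revE srcE.
have h_inj : injective (fun w => f (a (f' w))).
  by move=> w z /(can_inj fK)/(bij_inj bija)/(can_inj f'K).
have permf z : perm h_inj (f z) = f (a z) by rewrite permE fK.
have adj w z : hamming_adj w z -> hamming_adj (perm h_inj w) (perm h_inj z).
  case/embed_arc=> c [<- <-]; rewrite !permf -srcE -tgtE; exact: embed_adj.
exists (perm h_inj); split; last 2 first.
- by rewrite permf -srcE bx.
- by rewrite permf -tgtE bx.
apply/rot_autP; split=> w z.
  apply/idP/idP; last exact: adj.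
  (* Adjacency is reflected because every arc is the image under [b] of an arc. *)
  case/embed_arc=> c [cw cz]; have [b' _ bK] := bijb.
  have cE : c = b (b' c) by rewrite bK.
  rewrite cE srcE -permf in cw; rewrite cE tgtE -permf in cz.
  by rewrite -(perm_inj cw) -(perm_inj cz); exact: embed_adj.
case/embed_arc=> c [<- <-]; rewrite !permf -srcE -tgtE !next_neighbourE.
by rewrite rotE permf tgtE.
Qed.

Variables (F : finFieldType) (w : {unit F}) (hw : generator [set: {unit F}] w).
Variable c : W -> 'rV[F]_d.
Hypothesis cardF : #|F| = #|Q|.
Hypothesis c_inj : injective c.
Hypothesis c_adj : forall u v, hamming_adj u v = (c v - c u \in hamming_conn d F).
Hypothesis c_next : forall u v, hamming_adj u v ->
  c (next_neighbour u v) = c u + (c v - c u) *m hamming_mx d (val w).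

Lemma coordinates_map_iso : map_iso M (hamming_map d hw).
Proof.
have [bijf _ _ _] := fg_iso.
(* Both sides have q^d elements. *)
have [c' cK c'K] : bijective c.
  by apply: inj_card_bij => //; rewrite card_mx mul1n card_ffun card_ord cardF.
have gP x : c (f (target x)) - c (f (source x)) \in hamming_conn d F.
  by rewrite -c_adj; exact: embed_adj.
pose g2 x : cayley_arc d F :=
  (c (f (source x)), exist (fun s => s \in hamming_conn d F) _ (gP x)).
exists (c \o f), g2; split; first split.
- by apply: bij_comp bijf; exists c'.
- have g2_inj : injective g2.
    move=> x y [/c_inj sE]; rewrite sE => /addIr/c_inj tE.
    exact: embed_arc_inj.
  have onto a : exists x, g2 x == a.
    case: a => v s.
    have [|x [sx tx]] := @embed_arc (c' v) (c' (v + val s)).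
      by rewrite c_adj !c'K addrC addKr; exact: valP.
    exists x; apply/eqP; rewrite /g2; congr pair; first by rewrite sx c'K.
    by apply: val_inj; rewrite /= sx tx !c'K addrC addKr.
  exists (fun a => xchoose (onto a)) => a; last by apply/eqP/(xchooseP (onto a)).
  by apply: g2_inj; apply/eqP/(xchooseP (onto (g2 a))).
- by [].
- move=> x; rewrite /g2 /= /cayley_reverse /=; congr pair; first by rewrite subrKC.
  by apply: val_inj; rewrite /= /target reverseK opprB.
move=> x; rewrite /= permE /hamming_rot_fun /g2 /=.
congr pair; first by rewrite source_rotation.
apply: val_inj; rewrite /= -next_neighbourE c_next ?embed_adj //.
by rewrite source_rotation [RHS]addrC addKr.
Qed.

End RegularEmbedding.

Theorem theorem2p1 (d q : nat) (hd : (1 <= d)%N) (hq : (2 <= q)%N)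
    (Q : finType) (hQ : #|Q| = q) (M : oriented_map)
    (hM : orientably_regular_embedding (hamming_graph d Q) M) :
  (exists p k : nat, [/\ prime p, (0 < k)%N & q = (p ^ k)%N]) /\
  ((2 < q)%N ->
   forall F : finFieldType, #|F| = q ->
   exists (w : {unit F}) (hw : generator [set: {unit F}] w),
     map_iso M (hamming_map d hw)).
Proof.
(* For q = 2 the first claim is immediate and the second is vacuous. *)
have [q2|q_neq2] := eqVneq q 2; first by rewrite q2; split=> //; exists 2, 1%N.
have Q3 : (2 < #|Q|)%N by rewrite hQ ltn_neqAle eq_sym q_neq2.
have [regM [f [g fg_iso]]] := hM.
pose rho := next_neighbour f.
have rho_adj := next_neighbour_adj fg_iso.
have rho_cycle := next_neighbour_cycle fg_iso.
have arc_trans := next_neighbour_transitive fg_iso regM.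
have /card_gt0P[a _] : (0 < #|Q|)%N by exact: ltn_trans Q3.
pose u0 : {ffun 'I_d -> Q} := [ffun=> a].
have [b ba] := other_element Q3 (u0 (Ordinal hd)).
have uv0 := differ_at_subst ba.
have [p [K [p_pr abelK cardK frobK conjK]]] :=
  line_kernel Q3 rho_adj rho_cycle arc_trans uv0.
have [x [Ax xu xrho]] := rot_generator rho_adj rho_cycle arc_trans uv0.
have [sx dx] := rot_aut_directions Q3 Ax.
split=> [|_ F cardF].
  have ntK : K :!=: 1%g by rewrite -cardG_gt1 cardK (ltn_trans _ Q3).
  have [_ _ [k cardKp]] := pgroup_pdiv (abelem_pgroup abelK) ntK.
  by exists p, k.+1; rewrite -hQ -cardK.
have cardFQ : #|F| = #|Q| by rewrite hQ.
have [w [c [hw c_inj c_adj c_next]]] :=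
  coordinatisation Q3 rho_adj rho_cycle arc_trans uv0 Ax xu xrho dx
    p_pr abelK cardK frobK conjK cardFQ.
exists w, hw; exact: (coordinates_map_iso fg_iso hw cardFQ c_inj c_adj c_next).
Qed.
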